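(* Let $\alpha>\frac12$, let $k$ be a nonnegative integer, and let $$\delta=\sqrt{1-\frac{4\alpha^2-1}{(2k+2\alpha+1)^2-4}}\,.$$ Then $$\mathcal{M}_k^{\alpha}(\delta)<\frac{2}{\pi}\left(1+\frac{1}{8(k+\alpha)^2}\right)\quad\text{if } k\ge 2 \text{ is even},$$ and $$\mathcal{M}_k^{\alpha}(\delta)<\frac{230}{\pi}\quad\text{if } k\ge 3 \text{ is odd}.$$ Moreover, all local maxima of the function $M_k^{\alpha}(x)$ on $[-1,1]$ lie inside the interval $(-\delta,\delta)$.
   Context: For $\alpha>-1$, $\mathbf{P}_k^{(\alpha,\alpha)}$ denotes the orthonormal ultraspherical (Jacobi) polynomial of degree $k$, i.e. the sequence $(\mathbf{P}_k^{(\alpha,\alpha)})_{k\ge0}$ is orthonormal on $[-1,1]$ with respect to the weight $(1-x^2)^{\alpha}$. For $0<d\le 1$ and $|x|\le d$ define $$M_k^{\alpha}(x,d)=\sqrt{d^2-x^2}\,(1-x^2)^{\alpha}\left(\mathbf{P}_k^{(\alpha,\alpha)}(x)\right)^2,\qquad \mathcal{M}_k^{\alpha}(d)=\max_{|x|\le d}M_k^{\alpha}(x,d),$$ and $M_k^{\alpha}(x)=M_k^{\alpha}(x,1)=(1-x^2)^{\alpha+\frac12}\left(\mathbf{P}_k^{(\alpha,\alpha)}(x)\right)^2$ for $x\in[-1,1]$. *)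

(* Defs.v *)
From HB Require Import structures.
From mathcomp Require Import all_boot all_order all_algebra.
From mathcomp Require Import all_classical all_reals all_analysis.
Set Implicit Arguments.
Unset Strict Implicit.
Unset Printing Implicit Defensive.
Import Order.TTheory GRing.Theory Num.Theory.
Import numFieldNormedType.Exports.
Local Open Scope classical_set_scope.
Local Open Scope ring_scope.

(* Such a sequence P exists for every a > -1 and each P k is unique up to sign;
   only the squares (P k)^2 enter the quantities below, so no sign convention
   is imposed. *)
Definition orthonormal_ultraspherical (R : realType) (a : R)
    (P : nat -> {poly R}) : Prop :=
  (forall k, size (P k) = k.+1) /\
  (forall i j, (\int[lebesgue_measure]_(x in `[(-1 : R)%R, 1%R])
      ((1 - x ^+ 2) `^ a * ((P i).[x] * (P j).[x]))%R%:E)%E = (i == j)%:R%:E).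

(* The function (1 - x^2)^(a + 1/2) (P k)(x)^2 on [-1, 1] is the case d = 1.
   Note 0 `^ a = 0 for a != 0, so Mfun vanishes at the endpoints as it should
   when a > 0. *)
Definition Mfun (R : realType) (a : R) (P : nat -> {poly R}) (k : nat)
    (d x : R) : R :=
  Num.sqrt (d ^+ 2 - x ^+ 2) * (1 - x ^+ 2) `^ a * (P k).[x] ^+ 2.

(* For a > 0 and 0 <= d <= 1 the supremum is a maximum: see Mmax_attained. *)
Definition Mmax (R : realType) (a : R) (P : nat -> {poly R}) (k : nat)
    (d : R) : R :=
  sup [set Mfun a P k d x | x in [set x | `|x| <= d]].

(* Weak local maximum, relative to A: at a boundary point of A only the
   neighbouring points of A are compared. *)
Definition local_max_on (R : realType) (A : set R) (f : R -> R) (c : R) : Prop :=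
  A c /\ \forall y \near within A (nbhs c), f y <= f c.


Lemma Mmax_attained (R : realType) (a : R) (P : nat -> {poly R}) (k : nat)
    (d : R) : 0 < a -> 0 <= d <= 1 ->
  exists c, [/\ `|c| <= d, Mfun a P k d c = Mmax a P k d
    & forall x, `|x| <= d -> Mfun a P k d x <= Mmax a P k d].
Proof.
move=> a0 /andP[d0 d1].
pose g (y : R) := (Num.max y 0) `^ a.
have gc : continuous g.
  move=> y; have [y0|y0|->] := ltgtP y 0.
  - apply: (near_cst_continuous 0).
    near=> z; rewrite /g max_r ?powR0 ?gt_eqF//.
    by apply/ltW; near: z; exact: lt_nbhsl.
  - have h : {for y, continuous (fun z : R => z `^ a)}.
      apply/differentiable_continuous/derivable1_diffP.
      by apply: derivable_powR; rewrite in_itv/= y0.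
    rewrite /continuous_at /g max_l ?(ltW y0)//.
    apply: cvg_trans h; apply: near_eq_cvg; near=> z.
    rewrite max_l//; apply/ltW; near: z; exact: lt_nbhsr.
  - apply/left_right_continuousP; rewrite /g maxxx powR0 ?gt_eqF//; split.
      apply: (cvg_near_cst 0); near=> z.
      by rewrite max_r ?powR0 ?gt_eqF.
    apply: (cvg_trans _ (powR_cvg0 a0)); apply: near_eq_cvg; near=> z.
    by rewrite max_l.
pose f x := Num.sqrt (d ^+ 2 - x ^+ 2) * g (1 - x ^+ 2) * (P k).[x] ^+ 2.
have fc : continuous f.
  have pc (e : R) : continuous (fun x : R => e - x ^+ 2).
    by move=> x; apply: cvgB; [exact: cvg_cst|exact: exprn_continuous].
  move=> x; apply: cvgM; last first.
    by apply: cvgM; exact: continuous_horner.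
  apply: cvgM.
    exact: (continuous_comp (pc (d ^+ 2) x) (@sqrt_continuous R _)).
  exact: (continuous_comp (pc 1 x) (gc _)).
have fE x : `|x| <= d -> f x = Mfun a P k d x.
  move=> xd; rewrite /f /Mfun /g max_l// subr_ge0 -real_normK ?num_real//.
  by rewrite exprn_ile1// (le_trans xd).
have ledd : - d <= d by rewrite (le_trans _ d0)// oppr_le0.
have [c] := EVT_max ledd (continuous_subspaceT fc).
rewrite in_itv/= -ler_norml => cd cmax.
have ub x : `|x| <= d -> Mfun a P k d x <= Mfun a P k d c.
  by move=> xd; rewrite -!fE//; apply: cmax; rewrite in_itv/= -ler_norml.
have MmaxE : Mfun a P k d c = Mmax a P k d.
  apply/eqP; rewrite eq_le; apply/andP; split.
    apply: ub_le_sup; last by exists c.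
    by exists (Mfun a P k d c) => _ [x xd <-]; exact: ub.
  by apply: ge_sup; [exists (Mfun a P k d c), c|move=> _ [x xd <-]; exact: ub].
by exists c; split=> // x xd; rewrite -MmaxE; exact: ub.
Unshelve. all: by end_near. Qed.

(* Main.v *)
Require Import Defs.
From HB Require Import structures.
From mathcomp Require Import all_boot all_order all_algebra.
From mathcomp Require Import ring lra.
From mathcomp Require Import all_classical all_reals all_analysis.
Import Order.TTheory GRing.Theory Num.Theory.
Import numFieldNormedType.Exports.
Local Open Scope classical_set_scope.
Local Open Scope ring_scope.

(* With D = delta^2 - x^2 and g = D^(1/4) (1 - x^2)^(a/2) P_k one has
   g'' + p g' + b g = 0, and delta is chosen so that the Sonin function
   g^2 + g'^2/b is nonincreasing on [0, delta).  Hence M_k(., delta) = g^2 is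
   bounded by the value of the Sonin function at 0, which is delta P_k(0)^2 for
   even k and at most a constant times P_k'(0)^2 for odd k.  Two
   differentiations map degree k and parameter a to k - 2 and a + 2; going down
   to degree 0 expresses P_k(0)^2 through J(a) = \int (1 - x^2)^a, and sharp
   bounds for J follow from its recurrence and its monotonicity, the constant
   pi coming from J(1/2) = pi/2.  The odd case reduces to the even one by
   differentiating once.  For the local maxima, sin t compares by Sturm with
   the solution (sin t)^(a + 1/2) P_k(cos t) on the part of the circle where
   cos t >= delta, and the latter has no critical point there. *)

(* The max makes wt continuous on R: for y < 0, y `^ a is 1. *)
Definition wt (R : realType) (a x : R) : R := Num.max (1 - x ^+ 2) 0 `^ a.

(** The integrand enters as a formal polynomial, so that identities between integrals reduce to ring
    identities in [{poly R}]. *)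
HB.lock Definition Iw (R : realType) (a : R) (p : {poly R}) : R :=
  \int[lebesgue_measure]_(x in `[(-1 : R), 1]) (wt R a x * p.[x]).

(** * Weighted integrals of polynomials and integration by parts *)

Section weight.
Variable R : realType.
Implicit Types (a x : R) (p q : {poly R}).
Local Notation wt := (@wt R).
Local Notation Iw := (@Iw R).

Lemma wtE a x : x \in `[(-1 : R), 1]%R -> wt a x = (1 - x ^+ 2) `^ a.
Proof.
rewrite in_itv/= => /andP[? ?]; rewrite /wt max_l//; nra.
Qed.

Lemma continuous_wt a : 0 < a -> continuous (wt a).
Proof.
move=> a0.
pose g (y : R) := (Num.max y 0) `^ a.
suff gc : continuous g.
  move=> x; apply: (@continuous_comp _ _ _ (fun x : R => 1 - x ^+ 2) g); last exact: gc.
  by apply: cvgB; [exact: cvg_cst|exact: exprn_continuous].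
move=> y; have [y0|y0|->] := ltgtP y 0.
- apply: (near_cst_continuous 0).
  near=> z; rewrite /g max_r ?powR0 ?gt_eqF//.
  by apply/ltW; near: z; exact: lt_nbhsl.
- have h : {for y, continuous (fun z : R => z `^ a)}.
    apply/differentiable_continuous/derivable1_diffP.
    by apply: derivable_powR; rewrite in_itv/= y0.
  rewrite /continuous_at /g max_l ?(ltW y0)//.
  apply: cvg_trans h; apply: near_eq_cvg; near=> z.
  rewrite max_l//; apply/ltW; near: z; exact: lt_nbhsr.
(* At 0 the values on the left are all 0, a nonzero power of 0 being 0, and the limit from the right
   is 0 because [a > 0]. *)
- apply/left_right_continuousP; rewrite /g maxxx powR0 ?gt_eqF//; split.
    apply: (cvg_near_cst 0); near=> z.
    by rewrite max_r ?powR0 ?gt_eqF.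
  apply: (cvg_trans _ (powR_cvg0 a0)); apply: near_eq_cvg; near=> z.
  by rewrite max_l.
Unshelve. all: by end_near. Qed.

Lemma continuous_wt_horner a p : 0 < a -> continuous (fun x => wt a x * p.[x]).
Proof.
by move=> a0 x; apply: cvgM; [exact: continuous_wt|exact: continuous_horner].
Qed.

Lemma integrable_wt_horner a p : 0 < a ->
  lebesgue_measure.-integrable `[(-1 : R), 1] (EFin \o (fun x => wt a x * p.[x])).
Proof.
move=> a0; apply: continuous_compact_integrable; first exact: segment_compact.
by apply: continuous_subspaceT; exact: continuous_wt_horner.
Qed.

Lemma IwD a p q : 0 < a -> Iw a (p + q) = Iw a p + Iw a q.
Proof.
move=> a0; rewrite Iw.unlock -RintegralD//; try exact: integrable_wt_horner.
by apply: eq_Rintegral => x _; rewrite hornerD mulrDr.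
Qed.

Lemma IwZ a c p : 0 < a -> Iw a (c *: p) = c * Iw a p.
Proof.
move=> a0; rewrite Iw.unlock -RintegralZl//; last exact: integrable_wt_horner.
by apply: eq_Rintegral => x _; rewrite hornerZ mulrCA.
Qed.

Lemma IwB a p q : 0 < a -> Iw a (p - q) = Iw a p - Iw a q.
Proof. by move=> a0; rewrite IwD// -scaleN1r IwZ// mulN1r. Qed.

Lemma wtS a x : 0 < a -> wt (a + 1) x = wt a x * Num.max (1 - x ^+ 2) 0.
Proof.
move=> a0; rewrite /wt; have [->|m0] := eqVneq (Num.max (1 - x ^+ 2) 0) 0.
  by rewrite mulr0 powR0// gt_eqF// addr_gt0.
by rewrite powRD ?m0 ?implybT// powRr1// le_max lexx orbT.
Qed.

Lemma Iw_succ a p : 0 < a -> Iw (a + 1) p = Iw a ((1 - 'X^2) * p).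
Proof.
move=> a0; rewrite Iw.unlock; apply: eq_Rintegral => x; rewrite inE/= in_itv/= => /andP[? ?].
rewrite wtS// hornerM !hornerE max_l ?mulrA//; nra.
Qed.

Lemma is_derive_wt a x : x \in `](-1 : R), 1[%R ->
  is_derive x 1 (wt a) (- (2 * a * x) / (1 - x ^+ 2) * wt a x).
Proof.
move=> xI; move: (xI); rewrite in_itv/= => /andP[x1 x2].
have E0 : 0 < 1 - x ^+ 2 by nra.
have dd : is_derive x 1 (fun x : R => (1 - x ^+ 2) `^ a)
    (- (2 * a * x) / (1 - x ^+ 2) * wt a x).
  rewrite wtE ?in_itv/= ?(ltW x1) ?(ltW x2)//.
  have d1 : is_derive x 1 (fun x : R => 1 - x ^+ 2) (- (2 * x)).
    by apply: is_derive_eq; rewrite /GRing.scale/=; ring.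
  have d2 := @is_derive1_powR R a _ E0.
  apply: (trigger_derive (@is_derive1_comp _ (fun z : R => z `^ a) (fun x : R => 1 - x ^+ 2) x _ _ d2 d1)).
  have E1 : 1 - x ^+ 2 != 0 by rewrite gt_eqF.
  by rewrite powRB ?E1 ?implybT// powRr1 ?(ltW E0)//; field.
apply: (near_eq_is_derive _ dd).
near=> z; rewrite wtE//.
have : z \in `](-1 : R), 1[%R by near: z; exact: near_in_itvoo.
by rewrite !in_itv/= => /andP[/ltW-> /ltW->].
Unshelve. all: by end_near. Qed.

(** The integrand is the derivative of [(1 - x^2)^(a+1) p], which vanishes at both endpoints. The
    mass recurrence and the symmetry of the differential operator are instances. *)
Lemma Iw_derivE a p : 0 < a ->
  Iw a ((1 - 'X^2) * p^`() - (2 * (a + 1)) *: ('X * p)) = 0.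
Proof.
move=> a0; have a10 : 0 < a + 1 by rewrite addr_gt0.
pose F x := wt (a + 1) x * p.[x].
have N11 : (-1 : R) < 1 by rewrite (lt_trans (y := 0))// ltrN10.
have Fc : continuous F by exact: continuous_wt_horner.
have dF x : x \in `](-1 : R), 1[%R ->
    is_derive x 1 F (wt a x * ((1 - 'X^2) * p^`() - (2 * (a + 1)) *: ('X * p)).[x]).
  move=> xI; have d1 := is_derive_wt (a + 1) x xI.
  have E0 : 0 < 1 - x ^+ 2 by move: xI; rewrite in_itv/= => /andP[? ?]; nra.
  apply: (trigger_derive (is_deriveM d1 (is_derive_poly p x))).
  rewrite wtS// max_l ?(ltW E0)// !hornerE /GRing.scale/=; field.
  by rewrite gt_eqF.
rewrite Iw.unlock /Rintegral.
rewrite (@continuous_FTC2 _ _ F)//.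
- rewrite /F /wt !expr1n sqrrN expr1n subrr maxxx powR0 ?mul0r ?gt_eqF//.
  by rewrite -EFinB subrr.
- by apply: continuous_subspaceT; exact: continuous_wt_horner.
- split.
  + by move=> x /dF [].
  + by apply: cvg_at_right_filter; exact: Fc.
  + by apply: cvg_at_left_filter; exact: Fc.
- by move=> x /dF D; rewrite derive1E derive_val.
Qed.

End weight.

(** * Total masses of the weights *)

Section total_mass.
Variable R : realType.
Implicit Types (a b x : R) (p q : {poly R}) (n j : nat).
Local Notation wt := (@wt R).
Local Notation Iw := (@Iw R).
Local Notation J a := (Iw a 1).

(** Take [p = X] in [Iw_derivE]: the polynomial [1 - (2a+3) x^2] is a combination of [1 - x^2],
    which raises the parameter, and 1. *)
Lemma mass_succ a : 0 < a -> (a + 3 / 2) * J (a + 1) = (a + 1) * J a.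
Proof.
move=> a0; have := @Iw_derivE R a 'X a0.
rewrite derivX mulr1 -expr2 (_ : _ - _ = (2 * a + 3) *: ((1 - 'X^2) * 1)
    - (2 * (a + 1)) *: 1); last by rewrite -!mul_polyC; ring.
rewrite IwB// !IwZ// -Iw_succ//; lra.
Qed.

Lemma mass_mono a b : 0 < a -> a <= b -> J b <= J a.
Proof.
move=> a0 ab; rewrite Iw.unlock; apply: le_Rintegral => //.
- by apply: integrable_wt_horner; exact: lt_le_trans ab.
- exact: integrable_wt_horner.
move=> x xI; rewrite !hornerE ?mulr1 !wtE//.
(* A power decreases in its exponent when the base lies in [(0, 1]]; at the endpoints the base is 0
   and both sides vanish. *)
have [->|x1] := eqVneq (1 - x ^+ 2) 0.
  by rewrite !powR0// gt_eqF// (lt_le_trans a0).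
apply: ger_powR => //; move: xI; rewrite /= in_itv/= => /andP[? ?].
rewrite lt_neqAle eq_sym x1/=; apply/andP; split; nra.
Qed.

(** The substitution [x = sin t] turns the integrand into [cos^2 t], with primitive
    [(t + sin t cos t) / 2]. *)
Lemma mass_half : J (1 / 2) = pi / 2.
Proof.
have pi0 := @pi_gt0 R.
have lepi : - (pi / 2) < pi / 2 :> R by lra.
pose F t : R := (t + sin t * cos t) / 2.
have dF (t : R) : is_derive t 1 F (cos t ^+ 2).
  apply: is_derive_eq; rewrite /GRing.scale/=.
  rewrite mulr0 mulr0 add0r mulrN -!expr2.
  have -> : sin t ^+ 2 = 1 - cos t ^+ 2 by rewrite cos2sin2; ring.
  by field.
have csin : continuous (@sin R) by exact: continuous_sin.
have ccos : continuous (@cos R) by exact: continuous_cos.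
have sin' : ((@sin R)^`())%classic = cos.
  by apply/funext => u; rewrite derive1E derive_val.
have -> : J (1 / 2) = \int[lebesgue_measure]_(x in `[sin (- (pi / 2)) : R, sin (pi / 2)])
    (wt (1 / 2) x * (1 : {poly R}).[x]) by rewrite Iw.unlock sinN sin_pihalf.
rewrite /Rintegral.
rewrite (@integration_by_substitution_increasing R sin
    (fun x => wt (1 / 2) x * (1 : {poly R}).[x]) _ _ (ltW lepi)).
- under eq_integral => t tI.
    have -> : (((fun x => wt (1 / 2) x * (1 : {poly R}).[x]) \o sin)
               * ((@sin R)^`())%classic) t = cos t ^+ 2.
      rewrite sin' /= /GRing.mul/= -!/(GRing.mul _ _) hornerC mulr1.
      rewrite /wt -cos2sin2 max_l ?sqr_ge0// mul1r powR12_sqrt ?sqr_ge0//.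
      rewrite sqrtr_sqr ger0_norm//; apply: cos_ge0_pihalf.
      by move: tI; rewrite inE/= in_itv.
    over.
  rewrite (@continuous_FTC2 _ (fun t => cos t ^+ 2) F)//.
  + rewrite -EFinB/= /F sinN cosN cos_pihalf; by field.
  + apply: continuous_subspaceT => t.
    exact: (@continuous_comp _ _ _ cos (fun x => x ^+ 2) t (ccos t) (@exprn_continuous _ _ _)).
  + have cF : continuous F.
      by move=> t; apply/differentiable_continuous/derivable1_diffP; case: (dF t).
    split; first by move=> t _; case: (dF t).
      by apply: cvg_at_right_filter; exact: cF.
    by apply: cvg_at_left_filter; exact: cF.
  + by move=> t _; rewrite derive1E; case: (dF t).
- move=> s t sI tI st; rewrite ltr_sin//.
- by move=> t _; rewrite sin'; exact: ccos.
- by rewrite sin'; apply/cvg_ex; exists (cos (- (pi / 2))); apply: cvg_at_right_filter; exact: ccos.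
- by rewrite sin'; apply/cvg_ex; exists (cos (pi / 2)); apply: cvg_at_left_filter; exact: ccos.
- split; first by move=> t _; exact: ex_derive.
    by apply: cvg_at_right_filter; exact: csin.
  by apply: cvg_at_left_filter; exact: csin.
- by apply: continuous_subspaceT; apply: continuous_wt_horner; rewrite divr_gt0.
Qed.

Lemma mass_one : J 1 = 4 / 3.
Proof.
have N11 : (-1 : R) < 1 by lra.
pose F := horner ('X - (3^-1 : R) *: 'X^3 : {poly R}).
have cF : continuous F by exact: continuous_horner.
rewrite Iw.unlock /Rintegral (@continuous_FTC2 _ _ F)//.
- rewrite -EFinB/= /F !(hornerD, hornerN, hornerZ, hornerX, hornerXn); by field.
- by apply: continuous_subspaceT; exact: continuous_wt_horner.
- split; first by move=> t _; exact: derivable_horner.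
    by apply: cvg_at_right_filter; exact: cF.
  by apply: cvg_at_left_filter; exact: cF.
- move=> x; rewrite in_itv/= => /andP[? ?].
  rewrite -derivE derivB derivX derivZ derivXn !(hornerD, hornerN, hornerZ, hornerX, hornerXn, hornerMn, hornerC) wtE ?in_itv/=; last lra.
  rewrite powRr1; last nra.
  by field.
Qed.

End total_mass.

(** * Sharp bounds for the total masses *)

Section mass_bounds.
Variable R : realType.
Implicit Types (a b x : R) (n j : nat).
Local Notation J a := (@Iw R a 1).

(* The last hypothesis says that the limit of f is at least l. *)
Lemma lt_decreasing_seq (f : nat -> R) (l K K' : R) : 0 <= K' ->
  (forall n, f n.+1 < f n) ->
  (forall n, l * n%:R - K <= f n * (n%:R + K')) -> l < f 0%N.
Proof.
move=> K'0 fdec fl; rewrite ltNge; apply/negP => f0l.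
(* Starting from [f 1], strictly below [l], also excludes [f 0 = l]. Bounding [f n] by [f 1] in the
   last hypothesis then gives [n <= C] for all [n >= 1], which is absurd. *)
have f1l : f 1%N < l by exact: lt_le_trans f0l.
have fn n : f n.+1 <= f 1%N.
  by elim: n => // n; apply: le_trans; exact/ltW.
have d0 : 0 < l - f 1%N by rewrite subr_gt0.
pose C := (K + f 1%N * K') / (l - f 1%N).
have [n Cn] : exists n : nat, C < n%:R.
  by exists (Num.truncn `|C|).+1; rewrite (le_lt_trans (ler_norm C))// truncnS_gt.
have := le_trans (fl n.+1) (ler_wpM2r (addr_ge0 (ler0n _ _) K'0) (fn n)).
move: Cn; rewrite ltr_pdivrMr// -natr1 => Cn; nra.
Qed.

Lemma mass_half_gt0 j : 0 < J (j%:R + 1 / 2).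
Proof.
elim: j => [|j IH]; first by rewrite add0r mass_half divr_gt0// pi_gt0.
have j0 : 0 <= j%:R :> R by [].
have := @mass_succ R (j%:R + 1 / 2) (ltr_wpDl j0 _).
rewrite divr_gt0// => /(_ isT); rewrite [j%:R + 1 / 2 + 1]addrAC natr1 => e.
have : 0 < (j%:R + 1 / 2 + 3 / 2) * J (j.+1%:R + 1 / 2).
  by rewrite e mulr_gt0//; lra.
rewrite pmulr_rgt0//; lra.
Qed.

Lemma mass_gt0 a : 0 < a -> 0 < J a.
Proof.
move=> a0; apply: (lt_le_trans (mass_half_gt0 (Num.truncn a).+1)).
apply: mass_mono => //; apply: le_trans (ltW (truncnS_gt a)) _; lra.
Qed.

(** By [mass_succ] the product is the same for all [j], and at [j = 0] it is [(3/2) (pi/2) (4/3)].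
    This exact value fixes the limits in the bounds below. *)
Lemma mass_prod j :
  (j%:R + 3 / 2) * (J (j%:R + 1 / 2) * J (j%:R + 1)) = pi.
Proof.
elim: j => [|j IH]; first by rewrite !add0r mass_half mass_one; field.
have j0 : 0 <= j%:R :> R by [].
have e1 : (j%:R + 1 / 2 + 3 / 2) * J (j.+1%:R + 1 / 2)
    = (j%:R + 1 / 2 + 1) * J (j%:R + 1 / 2).
  rewrite -mass_succ; first by rewrite [j%:R + 1 / 2 + 1]addrAC natr1.
  lra.
have e2 : (j%:R + 1 + 3 / 2) * J (j.+1%:R + 1) = (j%:R + 1 + 1) * J (j%:R + 1).
  rewrite -mass_succ; first by rewrite natr1.
  lra.
rewrite -IH -[in LHS]natr1; apply: (@mulfI _ (j%:R + 2)); first by apply/eqP; lra.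
transitivity (((j%:R + 1 / 2 + 3 / 2) * J (j.+1%:R + 1 / 2)) *
  ((j%:R + 1 + 3 / 2) * J (j.+1%:R + 1))); first by rewrite natr1; field.
by rewrite e1 e2; field.
Qed.

(** By monotonicity [J a] is at least each of the two masses in [mass_prod]. The bound is crude, but
    taken along [a + n] it has the right leading order, which suffices to identify a limit. *)
Lemma mass_lower a n : 0 < a -> pi <= J a ^+ 2 * (n%:R + 3 / 2) \/ n%:R + 1 / 2 < a.
Proof.
move=> a0; have [an|] := leP a (n%:R + 1 / 2); last by right.
left; have n0 : 0 <= n%:R :> R by [].
rewrite -(mass_prod n) mulrC; apply: ler_wpM2r; first lra.
have h1 : J (n%:R + 1 / 2) <= J a by exact: mass_mono.
have h2 : J (n%:R + 1) <= J a by apply: mass_mono => //; lra.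
rewrite expr2; apply: ler_pM => //; apply/ltW; first exact: mass_half_gt0.
apply: mass_gt0; lra.
Qed.

(** The recurrence turns [J (j + 3/2) <= J (j + 1)] into an upper bound for [J (j + 1/2)] by a
    multiple of [J (j + 1)]; multiplying by [J (j + 1/2)] brings in [mass_prod]. *)
Lemma mass_upper j :
  J (j%:R + 1 / 2) ^+ 2 * (j%:R + 3 / 2) ^+ 2 <= pi * (j%:R + 2).
Proof.
have j0 : 0 <= j%:R :> R by [].
have e1 : (j%:R + 1 / 2 + 3 / 2) * J (j.+1%:R + 1 / 2)
    = (j%:R + 1 / 2 + 1) * J (j%:R + 1 / 2).
  rewrite -mass_succ; first by rewrite [j%:R + 1 / 2 + 1]addrAC natr1.
  lra.
have le : J (j.+1%:R + 1 / 2) <= J (j%:R + 1).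
  by apply: mass_mono; rewrite -?[j.+1%:R]natr1; lra.
have A0 := mass_half_gt0 j.
rewrite -(mass_prod j).
set A := J (j%:R + 1 / 2) in A0 e1 *; set B := J (j%:R + 1) in le *.
have e3 : A * (j%:R + 3 / 2) <= (j%:R + 2) * B.
  have -> : A * (j%:R + 3 / 2) = (j%:R + 2) * J (j.+1%:R + 1 / 2) by lra.
  by rewrite ler_wpM2l//; lra.
have : 0 <= A * (j%:R + 3 / 2) by rewrite mulr_ge0// ?(ltW A0)//; lra.
move=> h; rewrite -exprMn expr2 (_ : _ * (j%:R + 2) = A * (j%:R + 3 / 2) * ((j%:R + 2) * B)).
  by rewrite ler_wpM2l.
by ring.
Qed.

(** The quotient of the two sides, without [pi], strictly decreases along [a, a + 1, ...], as the
    recurrence gives its differences explicitly; [mass_lower] shows that its limit is at least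
    [pi]. *)
Lemma mass_gt a : 0 < a -> pi * (a + 1 / 4) < J a ^+ 2 * (a + 1 / 2) ^+ 2.
Proof.
move=> a0; rewrite -ltr_pdivlMr; last lra.
pose f n := J (a + n%:R) ^+ 2 * (a + n%:R + 1 / 2) ^+ 2 / (a + n%:R + 1 / 4).
have -> : J a ^+ 2 * (a + 1 / 2) ^+ 2 / (a + 1 / 4) = f 0%N by rewrite /f addr0.
pose m := Num.truncn a.
have am : a < m.+1%:R by exact: truncnS_gt.
(* The shift [m.+1 + 3/2] is that of [mass_lower] at index [m.+1 + n], which lies beyond [a + n]. *)
apply: (@lt_decreasing_seq f _ 0 (m.+1%:R + 3 / 2)).
- by have : 0 <= m.+1%:R :> R by []; lra.
- move=> n; rewrite /f -natr1 addrA; set b := a + n%:R.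
  have b0 : 0 < b by rewrite ltr_wpDr.
  have J0 := mass_gt0 _ b0.
  have -> : J (b + 1) = (b + 1) / (b + 3 / 2) * J b.
    apply: (@mulfI _ (b + 3 / 2)); first by apply/eqP; lra.
    rewrite mass_succ//; field; lra.
  rewrite -subr_gt0.
  have -> : J b ^+ 2 * (b + 1 / 2) ^+ 2 / (b + 1 / 4) -
    ((b + 1) / (b + 3 / 2) * J b) ^+ 2 * (b + 1 + 1 / 2) ^+ 2 / (b + 1 + 1 / 4)
    = J b ^+ 2 * (1 / 16) / ((b + 1 / 4) * (b + 5 / 4)).
    by field; apply/and3P; split; apply/eqP; lra.
  rewrite divr_gt0// mulr_gt0// ?exprn_gt0//; lra.
move=> n; rewrite subr0 /f; set b := a + n%:R.
have n0 : 0 <= n%:R :> R by [].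
have b0 : 0 < b by rewrite ltr_wpDr.
have [|] := mass_lower b (m.+1 + n)%N b0; last by rewrite natrD /b => ?; lra.
rewrite natrD => h; rewrite mulrAC ler_pdivlMr; last lra.
have J0 : 0 <= J b ^+ 2 by rewrite sqr_ge0.
have p0 := @pi_gt0 R.
set c := m.+1%:R + n%:R + 3 / 2 in h.
have -> : n%:R + (m.+1%:R + 3 / 2) = c by rewrite /c; ring.
rewrite [leRHS]mulrAC; apply: (@le_trans _ _ (pi * (b + 1 / 2) ^+ 2)).
  rewrite -mulrA ler_wpM2l ?(ltW p0)//; rewrite /b; nra.
by rewrite ler_wpM2r ?sqr_ge0.
Qed.

(** The left side strictly increases with [j] and its limit is at most [pi] by [mass_upper]; a
    change of sign makes the sequence decreasing. *)
Lemma mass_half_lt j : J (j%:R + 1 / 2) ^+ 2 * (j%:R + 5 / 4) < pi.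
Proof.
pose f n := - (J ((j + n)%:R + 1 / 2) ^+ 2 * ((j + n)%:R + 5 / 4)).
rewrite -ltrN2; have -> : - (J (j%:R + 1 / 2) ^+ 2 * (j%:R + 5 / 4)) = f 0%N.
  by rewrite /f addn0.
apply: (@lt_decreasing_seq f _ pi 0) => //.
- move=> n; rewrite /f addnS ltrN2 -[(j + n).+1%:R]natr1; set b := (j + n)%:R.
  have b0 : 0 <= b by rewrite /b.
  have J0 := mass_half_gt0 (j + n); rewrite -/b in J0.
  rewrite addrAC.
  have -> : J (b + 1 / 2 + 1) = (b + 3 / 2) / (b + 2) * J (b + 1 / 2).
    apply: (@mulfI _ (b + 1 / 2 + 3 / 2)); first by apply/eqP; lra.
    rewrite mass_succ//; last lra.
    field; lra.
  rewrite -subr_gt0.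
  have -> : ((b + 3 / 2) / (b + 2) * J (b + 1 / 2)) ^+ 2 * (b + 1 + 5 / 4) -
    J (b + 1 / 2) ^+ 2 * (b + 5 / 4) = J (b + 1 / 2) ^+ 2 * (1 / 16) / (b + 2) ^+ 2.
    by field; lra.
  by rewrite divr_gt0// ?mulr_gt0// ?exprn_gt0//; lra.
move=> n; rewrite addr0 /f !mulNr -opprD lerN2.
have := mass_upper (j + n); set b := (j + n)%:R => h.
have bn : n%:R <= b by rewrite /b ler_nat leq_addl.
have n0 : 0 <= n%:R :> R by [].
have p0 := @pi_gt0 R.
set A := J (b + 1 / 2) ^+ 2 in h *.
have A0 : 0 <= A by rewrite sqr_ge0.
have q0 : 0 < (b + 3 / 2) ^+ 2 by rewrite exprn_gt0//; lra.
rewrite -(ler_pM2r q0).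
apply: (@le_trans _ _ (pi * (b + 2) * ((b + 5 / 4) * n%:R))).
  rewrite (_ : _ * n%:R * _ = A * (b + 3 / 2) ^+ 2 * ((b + 5 / 4) * n%:R)); last by ring.
  by rewrite ler_wpM2r// mulr_ge0//; lra.
rewrite (_ : _ * _ + pi = pi * (n%:R + 1)); last by ring.
rewrite -!mulrA ler_wpM2l ?(ltW p0)//; nra.
Qed.

End mass_bounds.

(** * The ultraspherical equation *)

Definition uop (R : realType) (a : R) (y : {poly R}) : {poly R} :=
  (1 - 'X^2) * y^`()^`() - (2 * (a + 1)) *: ('X * y^`()).

(** Minus the eigenvalue of [uop a] in degree [k]. *)
Definition ueig (R : realType) (a : R) (k : nat) : R :=
  k%:R * (k%:R + 2 * a + 1).

Definition usol (R : realType) (a : R) (k : nat) (y : {poly R}) : Prop :=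
  uop R a y + ueig R a k *: y = 0.

Section ultraspherical.
Variable R : realType.
Implicit Types (a x : R) (p q y : {poly R}) (i j k m n : nat).
Local Notation Iw := (@Iw R).
Local Notation uop := (@uop R).
Local Notation ueig := (@ueig R).
Local Notation usol := (@usol R).
Local Notation J a := (@Iw a 1).

Lemma coef_uop a y i : (uop a y)`_i =
  i.+1%:R * i.+2%:R * y`_i.+2 - ueig a i * y`_i.
Proof.
rewrite /uop /ueig coefB coefZ mulrBl mul1r coefB coefXM coefXnM !coef_deriv.
case: i => [|[|i]].
- by rewrite /=; ring.
- by rewrite /=; ring.
rewrite !ltnS ltn0 !subSS subn0 (_ : (i.+2 == 0)%N = false)//.
by rewrite ![i.+2.-1]/=; ring.
Qed.

Lemma ueig_lt a i k : 0 < a -> (i < k)%N -> ueig a i < ueig a k.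
Proof.
move=> a0 ik; rewrite /ueig; have : i%:R < k%:R :> R by rewrite ltr_nat.
have : 0 <= i%:R :> R by [].
move=> *; nra.
Qed.

(** In the leading degree [i < k] the equation reads [(ueig a k - ueig a i) p_i = 0], and [ueig a]
    is strictly increasing. *)
Lemma usol_small a k p : 0 < a -> usol a k p -> (size p <= k)%N -> p = 0.
Proof.
move=> a0 sp pk; apply/eqP; rewrite -size_poly_eq0; apply/negPn/negP => p0.
set i := (size p).-1.
have si : size p = i.+1 by rewrite /i prednK// lt0n.
have ik : (i < k)%N by rewrite -si.
have /(congr1 (fun q : {poly R} => q`_i)) := sp.
rewrite coefD coefZ coef_uop coef0 [p`_i.+2]nth_default ?si// mulr0 sub0r.
move=> /eqP; rewrite -mulNr -mulrDl mulf_eq0 => /orP[|].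
  by rewrite addrC subr_eq0 gt_eqF// ueig_lt.
by move: p0; rewrite size_poly_eq0 -lead_coef_eq0 /lead_coef -/i => /negPf->.
Qed.

(** The operator preserves parity, so the part [q] of [y] of the wrong parity is again a solution.
    Its degree is below [k], because [k] has the right parity, so [usol_small] kills it. *)
Lemma usol_parity_coef a k y i : 0 < a -> usol a k y -> (size y <= k.+1)%N ->
  odd (i + k) -> y`_i = 0.
Proof.
move=> a0 sy yk ok.
pose q := \poly_(j < k) (if odd (j + k) then y`_j else 0).
have qE j : q`_j = if odd (j + k) then y`_j else 0.
  rewrite coef_poly; case: ltnP => // kj; case: ifP => // jk.
  rewrite nth_default// (leq_trans yk)// ltn_neqAle kj andbT.
  by apply: contraTN jk => /eqP->; rewrite addnn odd_double.
have : q = 0.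
  apply: (@usol_small a k) => //; last exact: size_poly.
  apply/polyP => j; rewrite coefD coefZ coef_uop coef0 !qE !addSn !oddS negbK.
  case: ifP => _; last by rewrite !mulr0 subr0 addr0.
  have /(congr1 (fun q : {poly R} => q`_j)) := sy.
  by rewrite coefD coefZ coef_uop coef0.
by move/(congr1 (fun q : {poly R} => q`_i)); rewrite qE ok coef0.
Qed.

Lemma usol_parity a k y x : 0 < a -> usol a k y -> (size y <= k.+1)%N ->
  y.[- x] = (-1) ^+ k * y.[x].
Proof.
move=> a0 sy yk; rewrite !horner_coef mulr_sumr; apply: eq_bigr => i _.
have [ok|ek] := boolP (odd (i + k)).
  by rewrite (usol_parity_coef a k)// !mul0r mulr0.
have ik : odd i = odd k by move: ek; rewrite oddD; case: (odd i); case: (odd k).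
by rewrite [(- x) ^+ _]exprNn mulrCA -(signr_odd _ i) ik signr_odd.
Qed.

(** Differentiate the equation and use [ueig a (k+1) - 2 (a+1) = ueig (a+1) k]. *)
Lemma usol_deriv a k y : usol a k.+1 y -> usol (a + 1) k y^`().
Proof.
move=> /(congr1 (@deriv R)); rewrite /usol /uop deriv0 => <-.
rewrite derivD derivB !derivZ !derivM derivB derivC derivXn derivX /ueig.
rewrite -!mul_polyC -natr1 !(rmorphD, rmorphM, rmorph1, rmorph_nat)/= -mulr_natl; ring.
Qed.

(** This is [Iw_derivE] for [p' q]. The right side is symmetric in [p] and [q], so the operator is
    self-adjoint. *)
Lemma uop_sym a p q : 0 < a ->
  Iw a (uop a p * q) = - Iw a ((1 - 'X^2) * (p^`() * q^`())).
Proof.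
move=> a0; have := @Iw_derivE R a (p^`() * q) a0.
rewrite derivM (_ : _ - _ = uop a p * q + (1 - 'X^2) * (p^`() * q^`())).
  by rewrite IwD// => /eqP; rewrite addr_eq0 => /eqP.
rewrite /uop -!mul_polyC; ring.
Qed.

Lemma Iw_deriv_sqr a k y : 0 < a -> usol a k y ->
  Iw (a + 1) (y^`() * y^`()) = ueig a k * Iw a (y * y).
Proof.
move=> a0 /eqP; rewrite addr_eq0 => /eqP sy.
have := uop_sym a y y a0.
by rewrite sy mulNr -scalerAl -scaleN1r !IwZ// mulN1r Iw_succ// => /oppr_inj.
Qed.

(* cbin m = 'C(2m, m) / 4 ^ m *)
Definition cbin m : R := \prod_(i < m) ((2 * i%:R + 1) / (2 * i%:R + 2)).

(** Induction by two differentiations: the equation at 0 gives [y''(0) = - ueig y(0)],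
    [Iw_deriv_sqr] used twice relates the norms, and [mass_succ] relates the masses. In degree 0 the
    polynomial is constant and its norm is a multiple of [J a]. *)
Lemma usol_at0 m a y : 0 < a -> usol a m.*2 y -> (size y <= m.*2.+1)%N ->
  y.[0] ^+ 2 * ((m%:R + a + 1 / 2) * J (a + m%:R)) =
  cbin m * (2 * m%:R + a + 1 / 2) * Iw a (y * y).
Proof.
elim: m a y => [|m IH] a y a0 sy yk.
  rewrite (size1_polyC yk) /cbin big_ord0 hornerC -polyCM -[in RHS]alg_polyC.
  rewrite IwZ// addr0; ring.
have a10 : 0 < a + 1 by rewrite addr_gt0.
have a20 : 0 < a + 1 + 1 by rewrite addr_gt0.
have m0 : 0 <= m%:R :> R by [].
have s1 : usol (a + 1) m.*2.+1 y^`() by apply: usol_deriv; rewrite -doubleS.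
have s2 : usol (a + 1 + 1) m.*2 y^`()^`() by exact: usol_deriv.
have size_d (p : {poly R}) n : (size p <= n.+1)%N -> (size p^`() <= n)%N.
  move=> pn; apply/leq_sizeP => j nj; rewrite coef_deriv.
  by rewrite nth_default ?mul0rn// (leq_trans pn).
have z1 : (size y^`() <= m.*2.+2)%N by exact: size_d yk.
have z2 := size_d _ _ z1.
have := IH _ _ a20 s2 z2.
rewrite (Iw_deriv_sqr _ _ _ a10 s1) (Iw_deriv_sqr _ _ _ a0 sy).
have -> : y^`()^`().[0] = - (ueig a m.+1.*2 * y.[0]).
  have /(congr1 (fun p : {poly R} => p.[0])) := sy.
  rewrite /uop !(hornerD, hornerN, hornerZ, hornerM, hornerXn, hornerX, hornerC).
  by rewrite ?expr0n/= !mul0r mulr0 !subr0 mul1r => /eqP; rewrite addr_eq0 => /eqP.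
have -> : a + 1 + 1 + m%:R = (a + m.+1%:R) + 1 by rewrite -natr1; ring.
have b0 : 0 < a + m.+1%:R by rewrite addr_gt0// ltr0n.
have := @mass_succ R _ b0.
rewrite /cbin big_ord_recr/= -/(cbin m) /ueig.
rewrite -!muln2 -[(m * 2).+1%:R]natr1 !natrM -[m.+1%:R]natr1.
set J1 := J (a + (m%:R + 1)); set J2 := J (a + (m%:R + 1) + 1).
set I := Iw a (y * y); set c := cbin m; set M := m%:R in m0 *; set y0 := y.[0].
move=> e1 e2.
(* [l] is [ueig a (2m+2)], the factor between [y''(0)] and [- y(0)]; it enters squared. *)
set l := (M + 1) * 2 * ((M + 1) * 2 + 2 * a + 1).
have l0 : l != 0 by apply/eqP; rewrite /l; nra.
apply: (@mulfI _ (l ^+ 2 * (a + M + 2))).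
  by rewrite mulf_neq0 ?expf_neq0//; apply/eqP; lra.
transitivity ((M + a + 3 / 2) * ((- (l * y0)) ^+ 2 * ((a + (M + 1) + 1) * J1))).
  by field.
rewrite -e1 (_ : a + (M + 1) + 3 / 2 = M + (a + 1 + 1) + 1 / 2); last by field.
rewrite /l e2; field; apply/eqP; lra.
Qed.

End ultraspherical.

(** * Size at the origin, and the equation for orthonormal polynomials *)

Section orthonormal.
Variable R : realType.
Implicit Types (a x : R) (p q y : {poly R}) (i j k m n : nat).
Local Notation Iw := (@Iw R).
Local Notation usol := (@usol R).
Local Notation cbin := (@cbin R).
Local Notation J a := (@Iw a 1).

(** Both sides obey the same recurrence. Through this identity [mass_half_lt] becomes a bound for
    [cbin]. *)
Lemma mass_cbin j : J (j%:R + 1 / 2) = pi * cbin j.+1.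
Proof.
elim: j => [|j IH].
  by rewrite /cbin big_ord1 mulr0 !add0r mass_half mul1r.
have j0 : 0 <= j%:R :> R by [].
apply: (@mulfI _ (j%:R + 1 / 2 + 3 / 2)); first by apply/eqP; lra.
rewrite -[j.+1%:R]natr1 [_ + 1 + 1 / 2]addrAC mass_succ ?IH; last lra.
rewrite {2}/cbin big_ord_recr/= -/(cbin j.+1) -[j.+1%:R]natr1; field; apply/eqP; lra.
Qed.

Lemma cbin_lt m : (0 < m)%N -> cbin m ^+ 2 * (pi * (m%:R + 1 / 4)) < 1.
Proof.
case: m => // m _; have p0 := @pi_gt0 R.
have := @mass_half_lt R m; rewrite mass_cbin -[m.+1%:R]natr1 => h.
rewrite -(ltr_pM2l p0) mulr1; apply: le_lt_trans h; rewrite le_eqVlt; apply/orP; left.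
by apply/eqP; field.
Qed.

(** Square [usol_at0], bound [cbin m] above by [cbin_lt] and the mass below by [mass_gt]. The two
    linear factors combine through [N^2 - a^2 = 4 (m + 1/4) (m + a + 1/4)]. *)
Lemma usol_at0_lt m a y N : N = m.*2%:R + a + 1 / 2 -> 0 < a -> (0 < m)%N -> usol a m.*2 y ->
  (size y <= m.*2.+1)%N -> 0 < Iw a (y * y) ->
  y.[0] ^+ 4 * (pi ^+ 2 * (N ^+ 2 - a ^+ 2)) < 4 * N ^+ 2 * Iw a (y * y) ^+ 2.
Proof.
move=> NE' a0 m0 sy yk I0.
have e := usol_at0 _ _ _ _ a0 sy yk.
have p0 := @pi_gt0 R.
have m00 : 0 < m%:R :> R by rewrite ltr0n.
have b0 : 0 < a + m%:R by rewrite addr_gt0.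
have hX := @mass_gt R _ b0.
have hc := @cbin_lt _ m0.
have NE : N = 2 * m%:R + a + 1 / 2 by rewrite NE' -muln2 natrM; ring.
rewrite -NE in e.
set c := cbin m in e hc; set I := Iw a (y * y) in e I0 *.
set X := (m%:R + a + 1 / 2) * J (a + m%:R) in e.
have hX' : pi * (m%:R + a + 1 / 4) < X ^+ 2.
  by rewrite /X exprMn [ltRHS]mulrC [m%:R + a]addrC.
have N0 : 0 < N by rewrite NE; lra.
have e4 : y.[0] ^+ 4 * X ^+ 2 = c ^+ 2 * (N ^+ 2 * I ^+ 2).
  by transitivity ((y.[0] ^+ 2 * X) ^+ 2); [ring|rewrite e; ring].
have y4 : 0 <= y.[0] ^+ 4 by rewrite (exprM _ 2 2) sqr_ge0.
have q0 : 0 < pi * (m%:R + 1 / 4) :> R by apply: mulr_gt0 => //; lra.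
have NI : 0 < N ^+ 2 * I ^+ 2 by rewrite mulr_gt0// exprn_gt0.
rewrite NE (_ : _ * (pi ^+ 2 * _) =
    4 * ((pi * (m%:R + 1 / 4)) * (y.[0] ^+ 4 * (pi * (m%:R + a + 1 / 4))))); last by field.
rewrite -?NE -[ltRHS]mulrA ltr_pM2l//; apply: (@le_lt_trans _ _
    (pi * (m%:R + 1 / 4) * (y.[0] ^+ 4 * X ^+ 2))).
  by apply: ler_wpM2l; [exact: ltW|apply: ler_wpM2l => //; exact: ltW].
rewrite e4 mulrA [_ * c ^+ 2]mulrC -[ltRHS]mul1r; by rewrite ltr_pM2r.
Qed.

Variables (a : R) (P : nat -> {poly R}).
Hypotheses (a0 : 0 < a) (hP : orthonormal_ultraspherical a P).

Lemma Iw_ortho i j : Iw a (P i * P j) = (i == j)%:R.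
Proof.
rewrite Iw.unlock; transitivity (\int[lebesgue_measure]_(x in `[(-1 : R), 1])
    ((1 - x ^+ 2) `^ a * ((P i).[x] * (P j).[x]))).
  by apply: eq_Rintegral => x; rewrite inE => xI; rewrite wtE// hornerM.
by rewrite /Rintegral hP.2.
Qed.

Lemma lead_reduction n q : (size q <= n.+1)%N ->
  exists c q', q = c *: P n + q' /\ (size q' <= n)%N.
Proof.
move=> qn; pose c := q`_n / (P n)`_n.
exists c, (q - c *: P n); split; first by rewrite addrC subrK.
have Pn0 : (P n)`_n != 0.
  by have := lead_coef_eq0 (P n); rewrite /lead_coef hP.1/= => ->; rewrite -size_poly_eq0 hP.1.
apply/leq_sizeP => j; rewrite leq_eqVlt => /predU1P[<-|nj].
  by rewrite coefB coefZ /c divfK// subrr.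
by rewrite coefB coefZ !nth_default ?mulr0 ?subr0// ?hP.1// (leq_trans qn).
Qed.

Lemma Iw_ortho_small k q : (size q <= k)%N -> Iw a (P k * q) = 0.
Proof.
suff H n : (n <= k)%N -> (size q <= n)%N -> Iw a (P k * q) = 0 by exact: H.
elim: n q => [|n IH] q nk.
  rewrite leqn0 size_poly_eq0 => /eqP->; rewrite mulr0.
  by rewrite -[X in Iw _ X](scale0r 0) IwZ// mul0r.
move=> /lead_reduction[c [q' [-> q'n]]].
rewrite mulrDr IwD// -scalerAr IwZ// Iw_ortho.
by rewrite gtn_eqF// mulr0 add0r IH//; exact: ltnW.
Qed.

Lemma Iw_nondegenerate n q : (size q <= n)%N ->
  (forall j, (j < n)%N -> Iw a (q * P j) = 0) -> q = 0.
Proof.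
elim: n q => [|n IH] q; first by rewrite leqn0 size_poly_eq0 => /eqP.
move=> /lead_reduction[c [q' [-> q'n]]] qP.
have c0 : c = 0.
  have := qP n (ltnSn n); rewrite mulrDl IwD// -scalerAl IwZ// Iw_ortho eqxx mulr1.
  by rewrite [q' * _]mulrC Iw_ortho_small// addr0.
rewrite c0 scale0r add0r; apply: IH => // j jn.
by have := qP j (ltnW jn); rewrite c0 scale0r add0r.
Qed.

(** The residue of the equation has degree below [k], since its top coefficient cancels. By
    self-adjointness it is orthogonal to [P j] for all [j < k], hence zero. *)
Lemma usol_ortho k : usol a k (P k).
Proof.
apply: (@Iw_nondegenerate k).
  apply/leq_sizeP => j kj; rewrite coefD coefZ coef_uop [(P k)`_j.+2]nth_default.
    rewrite mulr0 sub0r; move: kj; rewrite leq_eqVlt => /predU1P[->|kj].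
      by rewrite addNr.
    by rewrite nth_default ?hP.1// !mulr0 oppr0 addr0.
  by rewrite hP.1 ltnS (leq_trans kj)// -addn1 leq_add.
move=> j jk; rewrite mulrDl IwD// uop_sym// -scalerAl IwZ// Iw_ortho.
rewrite gtn_eqF// mulr0 addr0 [(P k)^`() * _]mulrC -uop_sym// mulrC Iw_ortho_small//.
apply/leq_sizeP => i ki; rewrite coef_uop !nth_default ?mulr0 ?subr0// hP.1.
  exact: leq_trans ki.
by rewrite (leq_trans jk)// (leq_trans ki)// -addn2 leq_addr.
Qed.

End orthonormal.

(** * Local maxima and the Sonin function *)

Section extrema.
Variable R : realType.
Implicit Types (a d x : R) (p q y : {poly R}) (i j k m n : nat).
Local Notation usol := (@usol R).
Local Notation ueig := (@ueig R).
Local Notation wt := (@wt R).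

Lemma usol_horner a k y x : usol a k y ->
  (1 - x ^+ 2) * y^`()^`().[x] = 2 * (a + 1) * x * y^`().[x] - ueig a k * y.[x].
Proof.
move=> /(congr1 (fun p : {poly R} => p.[x])).
rewrite /uop !(hornerD, hornerN, hornerZ, hornerM, hornerXn, hornerX, hornerC).
move=> /eqP; rewrite addr_eq0 -expr2 => /eqP e.
transitivity ((1 - x ^+ 2) * y^`()^`().[x] - 2 * (a + 1) * (x * y^`().[x])
   + 2 * (a + 1) * x * y^`().[x]); first by ring.
by rewrite e; ring.
Qed.

Lemma poly_eq0_itv p (u v : R) : u < v ->
  (forall x, u < x < v -> p.[x] = 0) -> p = 0.
Proof.
move=> uv p0; apply/eqP/negPn/negP => pn0.
(* Infinitely many distinct zeros; the shift [n.+2] keeps them strictly inside the interval. *)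
pose f n : R := u + (v - u) / n.+2%:R.
have finj : injective f.
  move=> i j /addrI /mulfI; rewrite subr_eq0 gt_eqF// => /(_ isT) /invr_inj /eqP.
  by rewrite eqr_nat => /eqP[].
have := @max_poly_roots _ p [seq f i | i <- iota 0 (size p)] pn0.
rewrite size_map size_iota ltnn map_inj_uniq// iota_uniq => /(_ _ isT) H.
suff : false by []; apply: H; apply/allP => _ /mapP[i _ ->].
apply/eqP/p0; rewrite /f ltrDl divr_gt0 ?subr_gt0//= -ltrBrDl.
by rewrite ltr_pdivrMr ?ltr0n// ltr_pMr ?subr_gt0// ltr1n.
Qed.

(* The derivative of (1 - x^2)^a (2 (1 - x^2) y y' - (2a - 1) x y^2) is a
   nonnegative factor times a sum of squares as soon as x >= d, and this function
   vanishes at 1. *)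
Lemma usol_log_derivative a k y d x : 1 / 2 < a -> usol a k y ->
  0 < d -> (1 - d ^+ 2) * (4 * ueig a k + 4 * a ^+ 2 + 4 * a - 3) = 4 * a ^+ 2 - 1 ->
  d <= x < 1 ->
  2 * (1 - x ^+ 2) * y.[x] * y^`().[x] <= (2 * a - 1) * x * y.[x] ^+ 2.
Proof.
move=> a2 sy d0 hd /andP[dx x1].
(* With [x = cos t] and [u = (sin t)^(a + 1/2) y(cos t)] one has
   [H = -2 (u / sin t) (u' sin t - u cos t)]: up to this factor, [H] is the Wronskian of the
   comparison with [sin t]. *)
pose q : {poly R} := 2 *: ((1 - 'X^2) * (y * y^`())) - (2 * a - 1) *: ('X * (y * y)).
pose H t := wt a t * q.[t].
have a0 : 0 < a by lra.
have qE t : q.[t] = 2 * (1 - t ^+ 2) * y.[t] * y^`().[t] - (2 * a - 1) * t * y.[t] ^+ 2.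
  rewrite /q !(hornerD, hornerN, hornerZ, hornerM, hornerXn, hornerX, hornerC); ring.
have inI t : t \in `]x, 1[%R -> t \in `](-1 : R), 1[%R.
  rewrite !in_itv/= => /andP[xt ->]; rewrite andbT; lra.
have E0 t : t \in `](-1 : R), 1[%R -> 0 < 1 - t ^+ 2.
  by rewrite in_itv/= => /andP[? ?]; nra.
have dH t : t \in `]x, 1[%R -> is_derive t 1 H (wt a t / (1 - t ^+ 2) *
    ((1 - t ^+ 2) * q^`().[t] - 2 * a * t * q.[t])).
  move=> /inI tI; have := E0 _ tI => Et.
  apply: (trigger_derive (is_deriveM (is_derive_wt _ a t tI) (is_derive_poly q t))).
  by rewrite /GRing.scale/=; field; rewrite gt_eqF.
have key t : t \in `]x, 1[%R -> 0 <= (1 - t ^+ 2) * q^`().[t] - 2 * a * t * q.[t].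
  move=> tI; have := E0 _ (inI _ tI); move: tI.
  rewrite in_itv/= => /andP[xt t1] Et.
  have e2 := usol_horner _ _ _ t sy.
  rewrite qE /q derivB !derivZ !derivM derivB derivC derivXn derivX.
  rewrite !(hornerD, hornerN, hornerZ, hornerM, hornerMn, hornerXn, hornerX, hornerC).
  set y0 := y.[t] in e2 *; set y1 := y^`().[t] in e2 *; set y2 := y^`()^`().[t] in e2 *.
  set Q := 4 * ueig a k + 4 * a ^+ 2 + 4 * a - 3 in hd.
  have Q0 : 0 < Q by have : 0 <= ueig a k; [rewrite /ueig mulr_ge0//; have : 0 <= k%:R :> R by []; lra|rewrite /Q; nra].
  suff -> : (1 - t ^+ 2) * (2 * ((0 - t ^+ 2.-1 *+ 2) * (y0 * y1) + (1 - t ^+ 2) * (y1 * y1 + y0 * y2))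
      - (2 * a - 1) * (1 * (y0 * y0) + t * (y1 * y0 + y0 * y1)))
      - 2 * a * t * (2 * (1 - t ^+ 2) * y0 * y1 - (2 * a - 1) * t * y0 ^+ 2)
    = 2 * ((1 - t ^+ 2) * y1 - (2 * a - 1) * t * y0 / 2) ^+ 2 + y0 ^+ 2 * (Q * (t ^+ 2 - d ^+ 2) / 2).
    apply: addr_ge0; apply: mulr_ge0; rewrite ?sqr_ge0// divr_ge0// mulr_ge0 ?(ltW Q0)//.
    by rewrite subr_ge0 ler_sqr ?nnegrE; lra.
  (* The choice of [d] enters here: [d] is the point where the coefficient of [y0 ^+ 2] changes
     sign. *)
  have hQ : Q * d ^+ 2 = Q - (4 * a ^+ 2 - 1) by rewrite -hd; ring.
  have -> : Q * (t ^+ 2 - d ^+ 2) = Q * t ^+ 2 - (Q - (4 * a ^+ 2 - 1)) by rewrite -hQ; ring.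
  transitivity (2 * (1 - t ^+ 2) * ((0 - t *+ 2) * (y0 * y1) + (1 - t ^+ 2) * y1 ^+ 2) +
     2 * (1 - t ^+ 2) * y0 * ((1 - t ^+ 2) * y2) - (1 - t ^+ 2) * (2 * a - 1) * (y0 ^+ 2 + 2 * t * y0 * y1)
     - 2 * a * t * (2 * (1 - t ^+ 2) * y0 * y1 - (2 * a - 1) * t * y0 ^+ 2)); first by rewrite /=; ring.
  by rewrite e2 /Q; field.
have cH : {within `[x, 1], continuous H}.
  by apply: continuous_subspaceT; exact: continuous_wt_horner.
have : H x <= H 1.
  apply: (@ger0_derive1_le_cc _ H x 1) => //.
  - by move=> t /dH [].
  - move=> t tI; have := dH t tI => -[_]; rewrite -derive1E => ->.
    by rewrite mulr_ge0 ?key// divr_ge0 ?powR_ge0// ltW// E0// inI.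
  - by rewrite in_itv/= lexx ltW.
  - by rewrite in_itv/= lexx ltW.
  - exact: ltW.
rewrite {2}/H /wt expr1n subrr maxxx powR0 ?gt_eqF// mul0r.
rewrite /H qE pmulr_rle0 ?subr_le0//.
have xI : x \in `](-1 : R), 1[%R by rewrite in_itv/= x1 andbT; lra.
by rewrite /wt powR_gt0// lt_max E0.
Qed.

(** At an interior critical point with [y(c) != 0] the value of [2 (1 - c^2) y y'] is
    [(2a+1) c y^2], while [usol_log_derivative] allows at most [(2a-1) c y^2]. *)
Lemma no_local_max a k y d c (e : R) : 1 / 2 < a -> usol a k y -> y != 0 ->
  0 < d -> (1 - d ^+ 2) * (4 * ueig a k + 4 * a ^+ 2 + 4 * a - 3) = 4 * a ^+ 2 - 1 ->
  d <= c <= 1 -> 0 < e ->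
  ~ (forall t, t \in `[(-1 : R), 1]%R -> `|t - c| < e ->
      wt (a + 1 / 2) t * y.[t] ^+ 2 <= wt (a + 1 / 2) c * y.[c] ^+ 2).
Proof.
move=> a2 sy y0 d0 hd /andP[dc c1] e0 cmax.
pose F t := wt (a + 1 / 2) t * (y * y).[t].
have FE t : F t = wt (a + 1 / 2) t * y.[t] ^+ 2 by rewrite /F hornerM -expr2.
have wt_gt0 t : t \in `](-1 : R), 1[%R -> 0 < wt (a + 1 / 2) t.
  rewrite in_itv/= => /andP[? ?]; apply: powR_gt0; rewrite lt_max; apply/orP; left; nra.
(* A maximum with value 0 would force [y] to vanish on an interval to the left of [c]. This also
   excludes [c = 1], where the weight vanishes. *)
have Fc : F c != 0.
  apply/eqP => Fc; move/eqP: y0; apply.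
  apply: (@poly_eq0_itv y (Num.max (-1) (c - e)) c).
    by rewrite gt_max; apply/andP; split; lra.
  move=> t; rewrite gt_max => /andP[/andP[t1 t2] tc].
  have tI : t \in `](-1 : R), 1[%R by rewrite in_itv/= t1 (lt_le_trans tc).
  have := cmax t; rewrite -!FE Fc FE => /(_ _ _)/wrap[].
    by apply: subset_itv_oo_cc.
    by rewrite ltr_norml; apply/andP; split; lra.
  rewrite pmulr_rle0 ?wt_gt0// => h; apply/eqP.
  by rewrite -sqrf_eq0 eq_le h sqr_ge0.
have c11 : c < 1.
  rewrite lt_neqAle c1 andbT; apply: contra Fc => /eqP->.
  by rewrite FE /wt expr1n subrr maxxx powR0 ?mul0r// gt_eqF//; lra.
have cI : c \in `](-1 : R), 1[%R by rewrite in_itv/= c11 andbT; lra.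
have dF t : t \in `](-1 : R), 1[%R -> is_derive t 1 F (wt (a + 1 / 2) t / (1 - t ^+ 2) *
    (2 * (1 - t ^+ 2) * y.[t] * y^`().[t] - (2 * a + 1) * t * y.[t] ^+ 2)).
  move=> tI; have Et : 1 - t ^+ 2 != 0.
    by move: tI; rewrite in_itv/= => /andP[? ?]; apply/eqP; nra.
  apply: (trigger_derive (is_deriveM (is_derive_wt _ _ t tI) (is_derive_poly (y * y) t))).
  by rewrite derivM !(hornerD, hornerM) /GRing.scale/=; field.
pose r := Num.min e (1 - c).
have r0 : 0 < r by rewrite lt_min e0 subr_gt0.
have re : r <= e by rewrite ge_min lexx.
have r1 : r <= 1 - c by rewrite ge_min lexx orbT.
have sub (t : R) : t \in `](c - r), (c + r)[%R -> t \in `](-1 : R), 1[%R.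
  by rewrite !in_itv/= => /andP[? ?]; apply/andP; split; lra.
have D0 : is_derive c 1 F 0.
  apply: (@derive1_at_max _ F (c - r) (c + r)).
  - lra.
  - by move=> t /sub /dF[].
  - by rewrite in_itv/=; apply/andP; split; lra.
  - move=> t tI; rewrite !FE; apply: cmax; first exact/subset_itv_oo_cc/sub.
    by move: tI; rewrite in_itv/= => /andP[? ?]; rewrite ltr_norml; apply/andP; split; lra.
have := dF c cI => -[_]; case: D0 => _ -> /esym/eqP.
have Ec : 0 < 1 - c ^+ 2 by nra.
rewrite mulf_eq0 gt_eqF ?divr_gt0 ?wt_gt0//= subr_eq0 => /eqP h.
have := usol_log_derivative a k y d c a2 sy d0 hd.
rewrite dc c11 h => /(_ isT) h2.
have yc : 0 < y.[c] ^+ 2.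
  by rewrite lt_neqAle sqr_ge0 andbT eq_sym; apply: contra Fc; rewrite FE => /eqP->; rewrite mulr0.
have : 0 < c * y.[c] ^+ 2 by rewrite mulr_gt0//; lra.
nra.
Qed.

(** The right side is the Sonin function [S] at 0, and the left side is [S] at [c] without its
    nonnegative derivative term. *)
Lemma sonin_monotone a k y d (c : R) : 1 / 2 < a -> usol a k y -> 0 < d ->
  (1 - d ^+ 2) * (4 * ueig a k + 4 * a ^+ 2 + 4 * a - 3) = 4 * a ^+ 2 - 1 ->
  d < 1 -> 0 <= c < d ->
  Num.sqrt (d ^+ 2 - c ^+ 2) * wt a c * y.[c] ^+ 2 <=
  d * (y.[0] ^+ 2 + 2 * d ^+ 2 * y^`().[0] ^+ 2 / (2 * (ueig a k + a) * d ^+ 2 + 1)).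
Proof.
move=> a2 sy d0 hd d1 /andP[c0 cd].
set l := ueig a k in hd *.
have l0 : 0 <= l by rewrite /l /ueig mulr_ge0//; have : 0 <= k%:R :> R by []; lra.
pose D (t : R) : R := d ^+ 2 - t ^+ 2.
pose E (t : R) : R := 1 - t ^+ 2.
(* With g = phi y and phi = D^(1/4) E^(a/2) one has g' = phi Z / (2 D E) and
   g'' + p g' + b g = 0 with b = B / (4 D^2 E^2), so that S = g^2 + g'^2 / b. *)
pose Z (t : R) := 2 * (d ^+ 2 - t ^+ 2) * (1 - t ^+ 2) * y^`().[t]
  - t * (1 - t ^+ 2 + 2 * a * (d ^+ 2 - t ^+ 2)) * y.[t].
pose B (t : R) := 4 * (l + a) * (d ^+ 2 - t ^+ 2) ^+ 2 * (1 - t ^+ 2)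
  - 4 * t ^+ 2 * (d ^+ 2 - t ^+ 2) * (1 - t ^+ 2) - 4 * a ^+ 2 * t ^+ 2 * (d ^+ 2 - t ^+ 2) ^+ 2
  + 2 * (d ^+ 2 - t ^+ 2) * (1 - t ^+ 2) ^+ 2 + 5 * t ^+ 2 * (1 - t ^+ 2) ^+ 2.
pose S (t : R) := Num.sqrt (d ^+ 2 - t ^+ 2) * wt a t * (y.[t] ^+ 2 + Z t ^+ 2 / B t).
pose u := 1 - d ^+ 2.
have u0 : 0 < u by rewrite /u; nra.
have u1 : u < 1 by rewrite /u; nra.
have BE t : B t = 4 * (l + a ^+ 2 + a) * D t ^+ 3 + (3 * u - 1) * D t ^+ 2
    + 2 * D t * E t ^+ 2 + 5 * t ^+ 2 * E t ^+ 2 - 4 * t ^+ 2 * E t * D t.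
  have e1 : 4 * (l + a ^+ 2 + a) * u = 4 * a ^+ 2 - 1 + 3 * u by rewrite -hd /u; ring.
  have -> : B t = 4 * (l + a ^+ 2 + a) * D t ^+ 3 + (4 * (l + a ^+ 2 + a) * u - 4 * a ^+ 2) * D t ^+ 2
    + 2 * D t * E t ^+ 2 + 5 * t ^+ 2 * E t ^+ 2 - 4 * t ^+ 2 * E t * D t.
    by rewrite /B /D /E /u; ring.
  by rewrite e1; ring.
have EDu t : E t = D t + u by rewrite /E /D /u; ring.
have B0 t : 0 < D t -> 0 < B t.
  (* Since [E = D + u] with [u > 0], regrouping in powers of [D] and [E - D] leaves only nonnegative
     terms, some of them positive. *)
  move=> Dt; rewrite BE; have Et := EDu t.
  have tE : t ^+ 2 = 1 - E t by rewrite /E; ring.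
  have t20 : 0 <= t ^+ 2 by rewrite sqr_ge0.
  have L0 : 0 < l + a ^+ 2 + a by nra.
  rewrite (_ : _ - _ = 4 * (l + a ^+ 2 + a) * D t ^+ 3 + (2 * u * D t ^+ 2 + D t ^+ 3)
    + (t ^+ 2 + 2 * D t) * (E t ^+ 2 - D t ^+ 2) + 4 * t ^+ 2 * E t * (E t - D t)); last first.
    rewrite tE Et; ring.
  have D3 : 0 < D t ^+ 3 by rewrite exprn_gt0.
  have D2 : 0 < D t ^+ 2 by rewrite exprn_gt0.
  have q1 : 0 < 4 * (l + a ^+ 2 + a) * D t ^+ 3 by rewrite mulr_gt0// mulr_gt0.
  have q2 : 0 < 2 * u * D t ^+ 2 by rewrite mulr_gt0// mulr_gt0.
  have q3 : 0 <= (t ^+ 2 + 2 * D t) * (E t ^+ 2 - D t ^+ 2).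
    by apply: mulr_ge0; rewrite ?Et; nra.
  have q4 : 0 <= 4 * t ^+ 2 * E t * (E t - D t).
    apply: mulr_ge0; last by rewrite Et; lra.
    by apply: mulr_ge0; [lra|rewrite Et; lra].
  lra.
have D0 x : 0 <= x <= c -> 0 < D x.
  by move=> /andP[x0 xc]; rewrite /D subr_gt0 ltr_pXn2r ?nnegrE//; lra.
have cont x : 0 <= x <= c -> is_derive x 1 S
   (- (Num.sqrt (d ^+ 2 - x ^+ 2) * wt a x * Z x ^+ 2 * (8 * x *
     (3 / 2 * u * D x ^+ 2 + (u + 3 / 2 * (1 - u)) * u * D x + 5 / 4 * (1 - u) * u ^+ 2
       + u * x ^+ 2 * (3 / 2 * D x + 5 / 2 * u))) / (D x * B x ^+ 2))).
  move=> /andP[x0 xc].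
  have xI : x \in `](-1 : R), 1[%R by rewrite in_itv/=; apply/andP; split; lra.
  have Dx : 0 < D x by rewrite D0// x0.
  have Ex : 0 < E x by rewrite EDu addr_gt0.
  have Bx : 0 < B x by exact: B0.
  have [Dn En Bn] : [/\ D x != 0, E x != 0 & B x != 0] by rewrite !gt_eqF.
  have dsqrt : is_derive x 1 (fun t : R => Num.sqrt (d ^+ 2 - t ^+ 2))
      (- x / D x * Num.sqrt (d ^+ 2 - x ^+ 2)).
    have h1 : is_derive x 1 (fun t : R => d ^+ 2 - t ^+ 2) (- (2 * x)).
      by apply: is_derive_eq; rewrite /GRing.scale/=; ring.
    have h2 := @is_derive1_sqrt R _ Dx.
    apply: (trigger_derive (@is_derive1_comp _ Num.sqrt (fun t : R => d ^+ 2 - t ^+ 2) x _ _ h2 h1)).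
    have : Num.sqrt (D x) ^+ 2 = D x by rewrite sqr_sqrtr// ltW.
    rewrite /D; set s := Num.sqrt _ => es.
    have s0 : s != 0 by rewrite gt_eqF// sqrtr_gt0.
    by rewrite -es; field.
  pose y0 := y.[x]; pose y1 := y^`().[x]; pose y2 := y^`()^`().[x].
  have dZ : is_derive x 1 Z (- 4 * x * (E x + D x) * y1 + 2 * D x * E x * y2
      - (E x + 2 * a * D x) * y0 + x * (2 * x + 4 * a * x) * y0
      - x * (E x + 2 * a * D x) * y1).
    apply: is_derive_eq; rewrite /GRing.scale/= /D /E /y0 /y1 /y2; ring.
  have dB : is_derive x 1 B (4 * (l + a) * (- 4 * x * D x * E x - 2 * x * D x ^+ 2)
      - 8 * x * D x * E x + 8 * x ^+ 3 * (E x + D x)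
      - 8 * a ^+ 2 * x * D x ^+ 2 + 16 * a ^+ 2 * x ^+ 3 * D x
      - 4 * x * E x ^+ 2 - 8 * x * D x * E x + 10 * x * E x ^+ 2 - 20 * x ^+ 3 * E x).
    apply: is_derive_eq; rewrite /GRing.scale/= /D /E; ring.
  have dy : is_derive x 1 (fun t => y.[t] ^+ 2) (2 * y0 * y1).
    by apply: is_derive_eq; rewrite /GRing.scale/= /y0 /y1; ring.
  have e2 : E x * y2 = 2 * (a + 1) * x * y1 - l * y0 by exact: usol_horner.
  have dwt := is_derive_wt R a x xI.
  move: dZ dB; set Z' := (X in is_derive x 1 Z X); set B' := (X in is_derive x 1 B X) => dZ dB.
  (* Expressing [y'] and [Z'] through [Z] and [y0] makes the terms in [y0^2] and [y0 Z] cancel in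
     [S'], leaving a multiple of [- Z^2 (B' D + 6 x B) / (D B^2)]. *)
  have k1 : 2 * D x * E x * y1 = Z x + x * (E x + 2 * a * D x) * y0.
    by rewrite /Z -/(D x) -/(E x) -/y0 -/y1; ring.
  have kZ : 2 * D x * E x * Z' = (2 * a * D x - 5 * E x) * x * Z x - B x * y0.
    transitivity (2 * D x * E x * (- 4 * x * (E x + D x) * y1
      - (E x + 2 * a * D x) * y0 + x * (2 * x + 4 * a * x) * y0
      - x * (E x + 2 * a * D x) * y1) + (2 * D x) ^+ 2 * E x * (E x * y2)).
      by rewrite /Z'; ring.
    by rewrite e2 /Z /B -/y0 -/y1 /D /E; ring.
  (* The relation defining [d] removes the one remaining term, in [x D^2], of undetermined sign; the
     rest is nonnegative for [x >= 0]. *)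
  have kB : 8 * x * (3 / 2 * u * D x ^+ 2 + (u + 3 / 2 * (1 - u)) * u * D x
      + 5 / 4 * (1 - u) * u ^+ 2 + u * x ^+ 2 * (3 / 2 * D x + 5 / 2 * u)) =
      B' * D x + 6 * x * B x.
    transitivity (B' * D x + 6 * x * B x - 2 * x * D x ^+ 2 *
        ((1 - d ^+ 2) * (4 * l + 4 * a ^+ 2 + 4 * a - 3) - (4 * a ^+ 2 - 1))).
      by rewrite /B' /B /D /E /u; field.
    by rewrite hd subrr mulr0 subr0.
  have y1E : y1 = (Z x + x * (E x + 2 * a * D x) * y0) / (2 * D x * E x).
    by rewrite -k1; field; rewrite Dn En.
  have Z'E : Z' = ((2 * a * D x - 5 * E x) * x * Z x - B x * y0) / (2 * D x * E x).
    by rewrite -kZ; field; rewrite Dn En.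
  have dT : is_derive x 1 (fun t => y.[t] ^+ 2 + Z t ^+ 2 / B t)
      (2 * y0 * y1 + 2 * Z x * Z' / B x - Z x ^+ 2 * B' / B x ^+ 2).
    clearbody Z' B' Z B.
    by apply: is_derive_eq; rewrite /GRing.scale/= /y0 /y1; field.
  apply: (trigger_derive (is_deriveM (is_deriveM dsqrt dwt) dT)).
  rewrite /GRing.scale/= kB -/(E x) y1E Z'E -/y0.
  clearbody Z' B' Z B D E.
  rewrite [X in X * (2 * y0 * _ + _ - _)](_ : _ = Num.sqrt (d ^+ 2 - x ^+ 2) * wt a x)//.
  by field; rewrite Dn En Bn.
have Scont : {within `[0, c], continuous S}.
  apply: derivable_within_continuous => x; rewrite in_itv/= => /cont[]//.
have : S c <= S 0.
  apply: (@ler0_derive1_le_cc _ S 0 c) => //.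
  - by move=> x /subset_itv_oo_cc; rewrite /= in_itv/= => /cont[].
  - move=> x /subset_itv_oo_cc; rewrite /= in_itv/= => xI; have [_] := cont x xI.
    rewrite -derive1E => ->; move: xI => /andP[x0 xc].
    have Dx : 0 < D x by rewrite D0// x0.
    rewrite oppr_le0 divr_ge0//; last by rewrite mulr_ge0 ?sqr_ge0// ltW.
    have w0 : 0 <= 1 - u by lra.
    have := ltW u0; have := ltW Dx => *.
    apply: mulr_ge0; first by rewrite mulr_ge0 ?sqr_ge0// mulr_ge0 ?sqrtr_ge0 ?powR_ge0.
    apply: mulr_ge0; first lra.
    set w := 1 - u in w0 *.
    by rewrite !addr_ge0 ?mulr_ge0 ?sqr_ge0//; lra.
  - by rewrite in_itv/= c0 lexx.
  - by rewrite in_itv/= lexx c0.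
have D00 : 0 < D 0 by rewrite D0// lexx.
move=> SS; apply: (@le_trans _ _ (S c)).
  rewrite /S ler_wpM2l// ?lerDl; first by rewrite mulr_ge0 ?sqrtr_ge0 ?powR_ge0.
  by rewrite divr_ge0 ?sqr_ge0// ltW// B0// D0// c0 lexx.
apply: le_trans SS _; rewrite le_eqVlt; apply/orP; left; apply/eqP.
have -> : S 0 = Num.sqrt (d ^+ 2 - 0 ^+ 2) * wt a 0 * (y.[0] ^+ 2 + Z 0 ^+ 2 / B 0) by [].
rewrite /wt expr0n/= !subr0 max_l// powR1 mulr1 sqrtr_sqr ger0_norm ?(ltW d0)//.
congr (_ * (_ + _)).
have -> : Z 0 = 2 * d ^+ 2 * y^`().[0] by rewrite /Z; ring.
have -> : B 0 = 2 * d ^+ 2 * (2 * (l + a) * d ^+ 2 + 1) by rewrite /B; ring.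
field; apply/andP; split; apply/eqP; nra.
Qed.

End extrema.

(** * Estimates for the orthonormal polynomials *)

Section envelope.
Variables (R : realType) (a : R) (P : nat -> {poly R}) (k : nat).
Hypotheses (ha : 1 / 2 < a) (hP : orthonormal_ultraspherical a P).
Local Notation lam := (ueig R a k).
Local Notation delta :=
  (Num.sqrt (1 - (4 * a ^+ 2 - 1) / ((2 * k%:R + 2 * a + 1) ^+ 2 - 4))).

Let bnd : [/\ 1 / 2 < a, 0 < a & 0 <= k%:R :> R].
Proof. by split=> //; rewrite (lt_trans _ ha). Qed.

(** The last component is the definition of [delta] with the denominator cleared. The condition
    [a > 1/2] makes the subtracted fraction positive, whence [delta < 1]. *)
Lemma delta_spec : [/\ 0 < delta, delta < 1 &
  (1 - delta ^+ 2) * (4 * lam + 4 * a ^+ 2 + 4 * a - 3) = 4 * a ^+ 2 - 1].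
Proof.
have [a2 a0 k0] := bnd.
set d2 := 1 - _.
have l0 : 0 <= lam by rewrite /ueig mulr_ge0//; lra.
have QE : (2 * k%:R + 2 * a + 1) ^+ 2 - 4 = 4 * lam + 4 * a ^+ 2 + 4 * a - 3.
  by rewrite /ueig; ring.
have Q0 : 0 < 4 * lam + 4 * a ^+ 2 + 4 * a - 3 by nra.
have e0 : 0 < (4 * a ^+ 2 - 1) / (4 * lam + 4 * a ^+ 2 + 4 * a - 3).
  by rewrite divr_gt0//; nra.
have d20 : 0 < d2.
  by rewrite /d2 QE subr_gt0 ltr_pdivrMr// mul1r; lra.
split; first by rewrite sqrtr_gt0.
  by rewrite -sqrtr1 ltr_sqrt// /d2 QE; lra.
by rewrite sqr_sqrtr ?(ltW d20)// /d2 QE; field; rewrite gt_eqF.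
Qed.

Lemma MfunE d t : t \in `[(-1 : R), 1]%R ->
  Mfun a P k d t = Num.sqrt (d ^+ 2 - t ^+ 2) * wt R a t * (P k).[t] ^+ 2.
Proof. by move=> tI; rewrite /Mfun wtE. Qed.

Lemma Mfun1E t : t \in `[(-1 : R), 1]%R ->
  Mfun a P k 1 t = wt R (a + 1 / 2) t * (P k).[t] ^+ 2.
Proof.
have [a2 a0 k0] := bnd.
move=> tI; rewrite /Mfun wtE//; congr (_ * _).
have E0 : 0 <= 1 - t ^+ 2 by move: tI; rewrite in_itv/= => /andP[? ?]; nra.
rewrite expr1n mul1r powRD; first by rewrite powR12_sqrt// mulrC.
by rewrite gt_eqF//; lra.
Qed.

Lemma Pparity t : (P k).[- t] ^+ 2 = (P k).[t] ^+ 2.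
Proof.
have [a2 a0 k0] := bnd.
rewrite (usol_parity R a k)//; last by rewrite hP.1.
  by rewrite exprMn sqrr_sign mul1r.
exact: usol_ortho.
Qed.

Lemma MfunN d t : Mfun a P k d (- t) = Mfun a P k d t.
Proof. by rewrite /Mfun sqrrN Pparity. Qed.

Lemma local_max_lt_delta c : local_max_on `[(-1 : R), 1] (Mfun a P k 1) c ->
  - delta < c < delta.
Proof.
have [a2 a0 k0] := bnd.
have [d0 d1 hd] := delta_spec; set d := delta in d0 d1 hd *.
move=> [cI]; rewrite near_withinE => /nbhs_ballP[e /= e0 cmax].
have sy := usol_ortho R a P a0 hP k.
have y0 : P k != 0 by rewrite -size_poly_eq0 hP.1.
have cI' : -1 <= c <= 1 by move: cI; rewrite /= in_itv.
rewrite -ltr_norml ltNge; apply/negP => dc.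
(* The function is even, so a local maximum at [c] is also one at [|c|]. *)
apply: (@no_local_max R a (k : nat) (P k) d `|c| e) => //.
  by rewrite dc ler_norml.
move=> t tI tc.
have nI : `|c| \in `[(-1 : R), 1]%R.
  by rewrite in_itv/= ler_norml cI' andbT (le_trans _ (normr_ge0 _))// lerN10.
rewrite -!Mfun1E//.
have [c0|c0] := leP 0 c.
  rewrite (ger0_norm c0) in tc *; apply: cmax => //.
  by rewrite /ball/= distrC.
rewrite (ltr0_norm c0) opprK in tc *; rewrite MfunN -[leLHS]MfunN; apply: cmax => //.
  by rewrite /ball/= opprK addrC.
by move: tI; rewrite /= !in_itv/= => /andP[? ?]; apply/andP; split; lra.
Qed.

(** The maximum is attained at some [|c| <= delta]. [sonin_monotone] covers [|c| < delta], and at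
    [|c| = delta] the function vanishes. *)
Lemma Mmax_le_sonin : Mmax a P k delta <= delta * ((P k).[0] ^+ 2 +
   2 * delta ^+ 2 * (P k)^`().[0] ^+ 2 / (2 * (lam + a) * delta ^+ 2 + 1)).
Proof.
have [a2 a0 k0] := bnd.
have [d0 d1 hd] := delta_spec; set d := delta in d0 d1 hd *.
have sy := usol_ortho R a P a0 hP k.
have l0 : 0 <= lam by rewrite /ueig mulr_ge0//; lra.
have dd : 0 <= d <= 1 by rewrite !ltW.
have [c [cd <- _]] := @Mmax_attained R a P k d a0 dd.
have -> : Mfun a P k d c = Mfun a P k d `|c|.
  by have [c0|c0] := leP 0 c; rewrite ?(ger0_norm c0) ?(ltr0_norm c0)// MfunN.
have [cd'|] := ltP `|c| d.
  rewrite MfunE; last by rewrite in_itv/=; have := normr_ge0 c; lra.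
  by apply: sonin_monotone => //; rewrite normr_ge0.
move=> dc; have -> : `|c| = d by apply/eqP; rewrite eq_le cd.
rewrite /Mfun subrr sqrtr0 !mul0r mulr_ge0 ?(ltW d0)// addr_ge0 ?sqr_ge0//.
apply: divr_ge0; first by apply: mulr_ge0; rewrite ?sqr_ge0// mulr_ge0 ?sqr_ge0.
by apply: addr_ge0 => //; apply: mulr_ge0; rewrite ?sqr_ge0//; lra.
Qed.

Lemma norm_Pk : Iw R a (P k * P k) = 1.
Proof. by have [_ a0 _] := bnd; rewrite Iw_ortho// eqxx. Qed.

Lemma delta_sqrE (N : R) : N = k%:R + a + 1 / 2 ->
  delta ^+ 2 * (N ^+ 2 - 1) = N ^+ 2 - a ^+ 2 - 3 / 4.
Proof.
have [a2 a0 k0] := bnd.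
have [_ _] := delta_spec; set d2 := delta ^+ 2 => hd ->.
rewrite /ueig in hd; lra.
Qed.

(** Here [P_k'(0) = 0]. By [usol_at0_lt] the square of [pi delta P_k(0)^2] is below
    [4 delta^2 N^2 / W], hence below [4 + 1/s^2], whose square root is at most
    [2 (1 + 1/(8 s^2))]. *)
Lemma Mmax_even : (2 <= k)%N -> ~~ odd k ->
  Mmax a P k delta < 2 / pi * (1 + 1 / (8 * (k%:R + a) ^+ 2)).
Proof.
have [a2 a0 k0] := bnd.
move=> k2 ek; apply: le_lt_trans Mmax_le_sonin _.
have [d0 d1 hd] := delta_spec; set d := delta in d0 d1 hd *.
have sy := usol_ortho R a P a0 hP k.
have p0 := @pi_gt0 R.
have -> : (P k)^`().[0] = 0.
  have c1 : (P k)`_1 = 0 by apply: (usol_parity_coef R a k) => //; rewrite hP.1.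
  by rewrite horner_coef0 coef_deriv c1 mul0rn.
rewrite expr0n/= mulr0 mul0r addr0.
set v := (P k).[0] ^+ 2; set s := k%:R + a.
have kr2 : 2 <= k%:R :> R by rewrite ler_nat.
have s2 : 2 < s by rewrite /s; lra.
pose m := k./2; have km : k = m.*2 by rewrite /m even_halfK.
have m0 : (0 < m)%N by rewrite half_gt0.
pose N := s + 1 / 2.
have := @usol_at0_lt R m a (P k) N; rewrite norm_Pk -km hP.1 => /(_ erefl a0 m0 sy (leqnn _) ltr01).
rewrite expr1n mulr1 (exprM _ 2 2) -/v => hv.
have hdN := delta_sqrE N erefl; rewrite -/d in hdN.
set W := N ^+ 2 - a ^+ 2 in hv hdN.
have W0 : 0 < W by rewrite /W subr_gt0 ltr_pXn2r ?nnegrE// /N /s; lra.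
have WN : W <= N ^+ 2 by rewrite /W gerBl sqr_ge0.
have N0 : 0 < N by rewrite /N; lra.
have N1 : 0 < N ^+ 2 - 1 by rewrite /N; nra.
have s20 : 0 < s ^+ 2 by rewrite exprn_gt0//; lra.
have h1 : d ^+ 2 * N ^+ 2 * (4 * s ^+ 2) <= (4 * s ^+ 2 + 1) * W.
  rewrite -(ler_pM2r N1).
  have -> : d ^+ 2 * N ^+ 2 * (4 * s ^+ 2) * (N ^+ 2 - 1) =
     (W - 3 / 4) * N ^+ 2 * (4 * s ^+ 2) by rewrite -hdN; ring.
  rewrite -subr_ge0 (_ : _ - _ = (N ^+ 2 - W) * (3 * s ^+ 2 - s + 3 / 4) + N ^+ 2 * (s - 3 / 4)).
    by rewrite addr_ge0// mulr_ge0 ?subr_ge0 ?sqr_ge0//; nra.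
  by rewrite /N; field.
have h2 : (d * v * pi) ^+ 2 < (2 * (1 + 1 / (8 * s ^+ 2))) ^+ 2.
  rewrite -(ltr_pM2r (mulr_gt0 W0 s20)).
  apply: (@lt_le_trans _ _ (4 * (d ^+ 2 * N ^+ 2 * s ^+ 2))).
    rewrite (_ : (d * v * pi) ^+ 2 * _ = d ^+ 2 * s ^+ 2 * (v ^+ 2 * (pi ^+ 2 * W))); last by ring.
    rewrite (_ : 4 * _ = d ^+ 2 * s ^+ 2 * (4 * N ^+ 2)); last by ring.
    by rewrite ltr_pM2l// mulr_gt0// exprn_gt0.
  have -> : 4 * (d ^+ 2 * N ^+ 2 * s ^+ 2) = d ^+ 2 * N ^+ 2 * (4 * s ^+ 2) by ring.
  apply: le_trans h1 _.
  have -> : (2 * (1 + 1 / (8 * s ^+ 2))) ^+ 2 * (W * s ^+ 2) =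
     (4 * s ^+ 2 + 1) * W + W / (16 * s ^+ 2) by field; apply/eqP; lra.
  by rewrite lerDl divr_ge0 ?(ltW W0)// mulr_ge0// ltW.
have v0 : 0 <= v by rewrite sqr_ge0.
have b0 : 0 <= 1 / (8 * s ^+ 2) by rewrite divr_ge0// mulr_ge0// ltW.
rewrite -(ltr_pM2r p0) (_ : 2 / pi * _ * pi = 2 * (1 + 1 / (8 * s ^+ 2))).
  have n1 : 0 <= d * v * pi by rewrite mulr_ge0 ?(ltW p0)// mulr_ge0// ltW.
  have n2 : 0 <= 2 * (1 + 1 / (8 * s ^+ 2)) by lra.
  by rewrite -(@ltr_pXn2r _ 2) ?nnegrE.
by field; apply/andP; split; rewrite gt_eqF//; lra.
Qed.

(** Here [P_k(0) = 0], and [P_k'] is a solution of even degree [k - 1] for [a + 1] with squared norm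
    [lam]. The shifts of degree and parameter compensate, so [N] is unchanged. *)
Lemma Mmax_odd : (3 <= k)%N -> odd k -> Mmax a P k delta < 230 / pi.
Proof.
have [a2 a0 k0] := bnd.
move=> k3 ok; apply: le_lt_trans Mmax_le_sonin _.
have [d0 d1 hd] := delta_spec; set d := delta in d0 d1 hd *.
have sy := usol_ortho R a P a0 hP k.
have p0 := @pi_gt0 R.
have -> : (P k).[0] = 0.
  by rewrite horner_coef0 (usol_parity_coef R a k)// hP.1.
rewrite expr0n/= add0r.
set v := (P k)^`().[0] ^+ 2.
pose m := k./2; have km : k = m.*2.+1 by rewrite /m -[LHS]odd_double_half ok.
have m0 : (0 < m)%N by rewrite half_gt0 ltnW.
have kr3 : 3 <= k%:R :> R by rewrite ler_nat.
have kmr : k%:R = m.*2%:R + 1 :> R by rewrite {1}km natr1.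
pose N := k%:R + a + 1 / 2.
have a10 : 0 < a + 1 by rewrite addr_gt0.
have l0 : 0 < lam by rewrite /ueig mulr_gt0; lra.
have sy1 : usol R (a + 1) m.*2 (P k)^`() by apply: usol_deriv; rewrite -km.
have I1 : Iw R (a + 1) ((P k)^`() * (P k)^`()) = lam.
  by rewrite (Iw_deriv_sqr R a k)// norm_Pk mulr1.
have s1 : (size (P k)^`() <= m.*2.+1)%N.
  by rewrite -km -ltnS -(hP.1 k) lt_size_deriv// -size_poly_eq0 hP.1.
have := @usol_at0_lt R m (a + 1) (P k)^`() N; rewrite I1.
have -> : N = m.*2%:R + (a + 1) + 1 / 2 by rewrite /N kmr; ring.
move=> /(_ erefl a10 m0 sy1 s1 l0).
have <- : N = m.*2%:R + (a + 1) + 1 / 2 by rewrite /N kmr; ring.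
rewrite (exprM _ 2 2) -/v => hv.
have hdN := delta_sqrE N erefl; rewrite -/d in hdN.
set W := N ^+ 2 - (a + 1) ^+ 2 in hv.
have v0 : 0 <= v by rewrite sqr_ge0.
have W0 : 0 < W by rewrite /W subr_gt0 ltr_pXn2r ?nnegrE// /N; lra.
have N2 : 2 <= N ^+ 2 by rewrite /N; nra.
(* One factor 2 comes from [N^2 <= 2 (N^2 - 1)], the other from [hW], where [k >= 3] makes [N] large
   enough compared with [a]. *)
have h1 : d ^+ 2 * N ^+ 2 <= 4 * W.
  have hW : N ^+ 2 - a ^+ 2 - 3 / 4 <= 2 * W by rewrite /W /N; nra.
  have dd : 0 <= d ^+ 2 by rewrite sqr_ge0.
  nra.
have h2 : (d * v * pi) ^+ 2 < (4 * lam) ^+ 2.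
  rewrite -(ltr_pM2r W0); apply: (@lt_le_trans _ _ (4 * lam ^+ 2 * (d ^+ 2 * N ^+ 2))).
    rewrite (_ : (d * v * pi) ^+ 2 * _ = d ^+ 2 * (v ^+ 2 * (pi ^+ 2 * W))); last by ring.
    rewrite (_ : 4 * _ * _ = d ^+ 2 * (4 * N ^+ 2 * lam ^+ 2)); last by ring.
    by rewrite ltr_pM2l// exprn_gt0.
  rewrite (_ : (4 * lam) ^+ 2 * W = 4 * lam ^+ 2 * (4 * W)); last by ring.
  by rewrite ler_wpM2l// mulr_ge0// sqr_ge0.
have h3 : d * v * pi < 4 * lam.
  have n1 : 0 <= d * v * pi by rewrite mulr_ge0 ?(ltW p0)// mulr_ge0// ltW.
  have n2 : 0 <= 4 * lam by lra.
  by rewrite -(@ltr_pXn2r _ 2) ?nnegrE.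
have d20 : 0 < d ^+ 2 by rewrite exprn_gt0.
have q0 : 0 < 2 * (lam + a) * d ^+ 2 + 1.
  by rewrite addr_gt0// mulr_gt0// mulr_gt0// addr_gt0.
rewrite ltr_pdivlMr// (_ : _ * pi = 2 * d ^+ 2 * (d * v * pi) / (2 * (lam + a) * d ^+ 2 + 1)).
  (* The quotient is below [8 lam d^2 / (2 (lam + a) d^2 + 1) < 4], well within 230. *)
  rewrite ltr_pdivrMr//; apply: (@le_lt_trans _ _ (2 * d ^+ 2 * (4 * lam))).
    by rewrite ler_wpM2l ?mulr_ge0 ?(ltW d20)// ltW.
  have := mulr_gt0 d20 l0; have := mulr_gt0 d20 a0; nra.
by field; rewrite gt_eqF.
Qed.

End envelope.

Theorem theorem3 (R : realType) (a : R) (P : nat -> {poly R}) (k : nat)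
    (ha : 1 / 2 < a) (hP : orthonormal_ultraspherical a P) :
  let delta :=
    Num.sqrt (1 - (4 * a ^+ 2 - 1) / ((2 * k%:R + 2 * a + 1) ^+ 2 - 4)) in
  [/\ ((2 <= k)%N -> ~~ odd k ->
        Mmax a P k delta < 2 / pi * (1 + 1 / (8 * (k%:R + a) ^+ 2))),
      ((3 <= k)%N -> odd k -> Mmax a P k delta < 230 / pi)
    & forall c : R, local_max_on `[(-1 : R), 1] (Mfun a P k 1) c ->
        - delta < c < delta].
Proof.
split.
- exact: Mmax_even.
- exact: Mmax_odd.
- exact: local_max_lt_delta.
Qed.
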